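(* Let $n$ be a positive integer and let $K$ be a field. Then $MC_n(K)$ is not a left V-ring.
   Context: A ring (associative with $1$) is a left V-ring if all its simple left modules are injective. $M_m(R)$ is the ring of $m\times m$ matrices over $R$. Identify $M_n(M_{n^k}(R))$ with $M_{n^{k+1}}(R)$ via block matrices. The $n$-matricial closure $MC_n(R)$ of a ring $R$ is the direct limit of the rings $M_{n^k}(R)$, $k\in\mathbb{N}=\{0,1,2,\dots\}$ (with $M_{n^0}(R)=R$), along the injective ring morphisms $M_{n^k}(R)\to M_{n^{k+1}}(R)$ sending $A$ to the block diagonal matrix with $n$ diagonal blocks equal to $A$.
   Formalization: The formal theorem assumes n ≥ 2 instead of n a positive integer: for n = 1 the ring MC_1(K) is K itself, a field, over which every module is injective, so the claim fails in that case. *)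

(* Defs.v *)
From HB Require Import structures.
From mathcomp Require Import all_boot all_order all_algebra generic_quotient.
From mathcomp Require Import boolp.

Set Implicit Arguments.
Unset Strict Implicit.
Unset Printing Implicit Defensive.

Import GRing.Theory.
Local Open Scope quotient_scope.
Local Open Scope ring_scope.

Definition injective_module (R : pzRingType) (E : lmodType R) : Prop :=
  forall (M N : lmodType R) (f : {linear M -> N}) (g : {linear M -> E}),
    injective f -> exists h : {linear N -> E}, forall x, h (f x) = g x.

(* Submodules are boolean predicates; by classical logic every Prop-valued
   submodule is of this form. *)
Definition simple_module (R : pzRingType) (S : lmodType R) : Prop :=
  (exists x : S, x <> 0) /\
  forall U : {pred S}, GRing.submod_closed U ->
    (forall x, x \in U -> x = 0) \/ (forall x, x \in U).

(* [lmodType R] is the type of left R-modules. *)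
Definition left_V_ring (R : pzRingType) : Prop :=
  forall S : lmodType R, simple_module S -> injective_module S.

Section DirectLimit.
Variables (R_ : nat -> pzRingType) (f : forall k, {rmorphism R_ k -> R_ k.+1}).

(* The image in [R_ m] of an element u of the disjoint union of the [R_ k],
   under the composite transition map; it is 0 (and never used) when
   [m < tag u]. *)
Fixpoint stage (m : nat) (u : {k & R_ k}) : R_ m :=
  match m return R_ m with
  | 0 => untag 0 (fun x : R_ 0 => x) u
  | p.+1 => if (tag u <= p)%N then f p (stage p u)
            else untag 0 (fun x : R_ p.+1 => x) u
  end.

(* Two elements are identified when they agree at some later stage. *)
Definition dlim_rel (u v : {k & R_ k}) : bool :=
  `[< exists m, [/\ (tag u <= m)%N, (tag v <= m)%N & stage m u = stage m v] >].

Lemma stage_tag (k : nat) (x : R_ k) : stage k (Tagged R_ x) = x.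
Proof.
have E : untag 0 (fun y : R_ k => y) (Tagged R_ x) = x by rewrite untagE.
by case: k x E => [|k] x E //=; rewrite ltnn.
Qed.

Lemma stageS (m : nat) (u : {k & R_ k}) :
  (tag u <= m)%N -> stage m.+1 u = f m (stage m u).
Proof. by move=> /= ->. Qed.

Lemma stage_stage (m p : nat) (u : {k & R_ k}) : (tag u <= m <= p)%N ->
  stage p (Tagged R_ (stage m u)) = stage p u.
Proof.
move=> /andP[um]; elim: p => [|p IHp] mp.
  by move: mp um; rewrite leqn0 => /eqP -> um; rewrite stage_tag.
move: mp; rewrite leq_eqVlt ltnS => /orP[/eqP <-|mp]; first by rewrite stage_tag.
by rewrite !stageS ?IHp //; exact: (leq_trans _ mp).
Qed.

Lemma stage_eq_le (m p : nat) (u v : {k & R_ k}) :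
    (tag u <= m)%N -> (tag v <= m)%N -> (m <= p)%N ->
  stage m u = stage m v -> stage p u = stage p v.
Proof.
move=> um vm mp e.
by rewrite -(@stage_stage m p u) ?um // -(@stage_stage m p v) ?vm // e.
Qed.

Lemma dlim_relP (u v : {k & R_ k}) :
  reflect (exists m, forall p, (m <= p)%N -> stage p u = stage p v)
          (dlim_rel u v).
Proof.
rewrite /dlim_rel; apply: (iffP (asboolP _)) => [[m [um vm e]]|[m e]].
  by exists m => p mp; exact: stage_eq_le e.
exists (maxn m (maxn (tag u) (tag v))).
by rewrite !leq_max !leqnn !orbT; split=> //; rewrite e // leq_maxl.
Qed.

Lemma dlim_rel_refl : reflexive dlim_rel.
Proof. by move=> u; apply/dlim_relP; exists 0%N. Qed.

Lemma dlim_rel_sym : symmetric dlim_rel.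
Proof.
by move=> u v; apply/dlim_relP/dlim_relP => -[m e]; exists m => p /e ->.
Qed.

Lemma dlim_rel_trans : transitive dlim_rel.
Proof.
move=> v u w /dlim_relP[m e] /dlim_relP[n e']; apply/dlim_relP.
by exists (maxn m n) => p; rewrite geq_max => /andP[/e -> /e' ->].
Qed.

Canonical dlim_equiv := EquivRel dlim_rel dlim_rel_refl dlim_rel_sym dlim_rel_trans.

Definition dlim : Type := {eq_quot dlim_rel}.
HB.instance Definition _ := Choice.on dlim.
HB.instance Definition _ := EqQuotient.on dlim.

Definition dlim_in (k : nat) (x : R_ k) : dlim := \pi_dlim (Tagged R_ x).

Definition dlim_add_rep (u v : {k & R_ k}) : {k & R_ k} :=
  let m := maxn (tag u) (tag v) in Tagged R_ (stage m u + stage m v).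
Definition dlim_mul_rep (u v : {k & R_ k}) : {k & R_ k} :=
  let m := maxn (tag u) (tag v) in Tagged R_ (stage m u * stage m v).
Definition dlim_opp_rep (u : {k & R_ k}) : {k & R_ k} :=
  Tagged R_ (- tagged u).

Definition dlim_zero : dlim := dlim_in (0 : R_ 0).
Definition dlim_one : dlim := dlim_in (1 : R_ 0).
Definition dlim_add (x y : dlim) : dlim :=
  \pi_dlim (dlim_add_rep (repr x) (repr y)).
Definition dlim_mul (x y : dlim) : dlim :=
  \pi_dlim (dlim_mul_rep (repr x) (repr y)).
Definition dlim_opp (x : dlim) : dlim := \pi_dlim (dlim_opp_rep (repr x)).

Lemma dlim_piP (u v : {k & R_ k}) :
  (exists m, forall p, (m <= p)%N -> stage p u = stage p v) <->
  \pi_dlim u = \pi_dlim v.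
Proof.
split=> [/dlim_relP e|/eqmodP/dlim_relP //].
exact/eqmodP.
Qed.

Lemma stage_morph (g : forall k, R_ k -> R_ k) (m p : nat) (u : {k & R_ k}) :
    (forall k x, f k (g k x) = g k.+1 (f k x)) -> (tag u <= m <= p)%N ->
  stage p (Tagged R_ (g m (stage m u))) = g p (stage p u).
Proof.
move=> fg /andP[um]; elim: p => [|p IHp] mp.
  by move: mp um; rewrite leqn0 => /eqP -> um; rewrite stage_tag.
move: mp; rewrite leq_eqVlt ltnS => /orP[/eqP <-|mp]; first by rewrite stage_tag.
by rewrite !stageS ?IHp ?fg //; exact: (leq_trans _ mp).
Qed.

Lemma stage_morph2 (g : forall k, R_ k -> R_ k -> R_ k) (m p : nat)
    (u v : {k & R_ k}) :
    (forall k x y, f k (g k x y) = g k.+1 (f k x) (f k y)) ->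
    (tag u <= m)%N -> (tag v <= m)%N -> (m <= p)%N ->
  stage p (Tagged R_ (g m (stage m u) (stage m v))) = g p (stage p u) (stage p v).
Proof.
move=> fg um vm; elim: p => [|p IHp] mp.
  by move: mp um vm; rewrite leqn0 => /eqP -> um vm; rewrite stage_tag.
move: mp; rewrite leq_eqVlt ltnS => /orP[/eqP <-|mp]; first by rewrite stage_tag.
by rewrite !stageS ?IHp ?fg //; exact: (leq_trans _ mp).
Qed.

Lemma stage_add (p : nat) (u v : {k & R_ k}) : (maxn (tag u) (tag v) <= p)%N ->
  stage p (dlim_add_rep u v) = stage p u + stage p v.
Proof.
move=> h; apply: (@stage_morph2 (fun k x y => x + y)) h; last 2 first.
- exact: leq_maxl.
- exact: leq_maxr.
by move=> k x y; rewrite rmorphD.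
Qed.

Lemma stage_mul (p : nat) (u v : {k & R_ k}) : (maxn (tag u) (tag v) <= p)%N ->
  stage p (dlim_mul_rep u v) = stage p u * stage p v.
Proof.
move=> h; apply: (@stage_morph2 (fun k x y => x * y)) h; last 2 first.
- exact: leq_maxl.
- exact: leq_maxr.
by move=> k x y; rewrite rmorphM.
Qed.

Lemma stage_opp (p : nat) (u : {k & R_ k}) : (tag u <= p)%N ->
  stage p (dlim_opp_rep u) = - stage p u.
Proof.
case: u => k x h; rewrite /dlim_opp_rep /= -{1}(stage_tag x).
apply: (@stage_morph (fun k x => - x)); last by rewrite /= leqnn.
by move=> j y; rewrite rmorphN.
Qed.

Lemma stage0 (p : nat) : stage p (Tagged R_ (0 : R_ 0)) = 0.
Proof. by elim: p => [|p IHp]; rewrite ?stage_tag // stageS // IHp rmorph0. Qed.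

Lemma stage1 (p : nat) : stage p (Tagged R_ (1 : R_ 0)) = 1.
Proof. by elim: p => [|p IHp]; rewrite ?stage_tag // stageS // IHp rmorph1. Qed.

Lemma dlim_addE (u v : {k & R_ k}) :
  dlim_add (\pi_dlim u) (\pi_dlim v) = \pi_dlim (dlim_add_rep u v).
Proof.
have /dlim_piP[m e] := reprK (\pi_dlim u).
have /dlim_piP[m' e'] := reprK (\pi_dlim v).
apply/dlim_piP; set u' := repr _ in e *; set v' := repr _ in e' *.
exists (maxn (maxn m m') (maxn (maxn (tag u) (tag v)) (maxn (tag u') (tag v')))).
move=> p; rewrite !geq_max => /andP[/andP[mp mp'] /andP[h h']].
by rewrite !stage_add ?geq_max // e // e'.
Qed.

Lemma dlim_mulE (u v : {k & R_ k}) :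
  dlim_mul (\pi_dlim u) (\pi_dlim v) = \pi_dlim (dlim_mul_rep u v).
Proof.
have /dlim_piP[m e] := reprK (\pi_dlim u).
have /dlim_piP[m' e'] := reprK (\pi_dlim v).
apply/dlim_piP; set u' := repr _ in e *; set v' := repr _ in e' *.
exists (maxn (maxn m m') (maxn (maxn (tag u) (tag v)) (maxn (tag u') (tag v')))).
move=> p; rewrite !geq_max => /andP[/andP[mp mp'] /andP[h h']].
by rewrite !stage_mul ?geq_max // e // e'.
Qed.

Lemma dlim_oppE (u : {k & R_ k}) :
  dlim_opp (\pi_dlim u) = \pi_dlim (dlim_opp_rep u).
Proof.
have /dlim_piP[m e] := reprK (\pi_dlim u).
apply/dlim_piP; set u' := repr _ in e *.
exists (maxn m (maxn (tag u) (tag u'))) => p; rewrite !geq_max.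
by move=> /and3P[mp h h']; rewrite !stage_opp // e.
Qed.

Lemma dlim_in_stage (m : nat) (u : {k & R_ k}) : (tag u <= m)%N ->
  dlim_in (stage m u) = \pi_dlim u.
Proof.
by move=> um; apply/dlim_piP; exists m => p mp; rewrite stage_stage // um.
Qed.

Lemma dlim_in_add (k : nat) (x y : R_ k) :
  dlim_in (x + y) = dlim_add (dlim_in x) (dlim_in y).
Proof.
by rewrite dlim_addE /dlim_in /dlim_add_rep/= maxnn !stage_tag.
Qed.

Lemma dlim_in_mul (k : nat) (x y : R_ k) :
  dlim_in (x * y) = dlim_mul (dlim_in x) (dlim_in y).
Proof.
by rewrite dlim_mulE /dlim_in /dlim_mul_rep/= maxnn !stage_tag.
Qed.

Lemma dlim_in_opp (k : nat) (x : R_ k) : dlim_in (- x) = dlim_opp (dlim_in x).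
Proof. by rewrite dlim_oppE. Qed.

Lemma dlim_in0 (k : nat) : dlim_in (0 : R_ k) = dlim_zero.
Proof. by rewrite -(stage0 k) dlim_in_stage. Qed.

Lemma dlim_in1 (k : nat) : dlim_in (1 : R_ k) = dlim_one.
Proof. by rewrite -(stage1 k) dlim_in_stage. Qed.

Lemma dlim_in_surj3 (x y z : dlim) : exists k (a b c : R_ k),
  [/\ x = dlim_in a, y = dlim_in b & z = dlim_in c].
Proof.
elim/quotW: x => u; elim/quotW: y => v; elim/quotW: z => w.
pose m := maxn (tag u) (maxn (tag v) (tag w)).
exists m, (stage m u), (stage m v), (stage m w).
by rewrite !dlim_in_stage // !leq_max leqnn ?orbT.
Qed.

Lemma dlim_addA : associative dlim_add.
Proof.
move=> x y z; have [k [a [b [c [-> -> ->]]]]] := dlim_in_surj3 x y z.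
by rewrite -!dlim_in_add addrA.
Qed.

Lemma dlim_addC : commutative dlim_add.
Proof.
move=> x y; have [k [a [b [c [-> -> _]]]]] := dlim_in_surj3 x y x.
by rewrite -!dlim_in_add addrC.
Qed.

Lemma dlim_add0 : left_id dlim_zero dlim_add.
Proof.
move=> x; have [k [a [b [c [-> _ _]]]]] := dlim_in_surj3 x x x.
by rewrite -(dlim_in0 k) -dlim_in_add add0r.
Qed.

Lemma dlim_addN : left_inverse dlim_zero dlim_opp dlim_add.
Proof.
move=> x; have [k [a [b [c [-> _ _]]]]] := dlim_in_surj3 x x x.
by rewrite -(dlim_in0 k) -dlim_in_opp -dlim_in_add addNr.
Qed.

Lemma dlim_mulA : associative dlim_mul.
Proof.
move=> x y z; have [k [a [b [c [-> -> ->]]]]] := dlim_in_surj3 x y z.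
by rewrite -!dlim_in_mul mulrA.
Qed.

Lemma dlim_mul1l : left_id dlim_one dlim_mul.
Proof.
move=> x; have [k [a [b [c [-> _ _]]]]] := dlim_in_surj3 x x x.
by rewrite -(dlim_in1 k) -dlim_in_mul mul1r.
Qed.

Lemma dlim_mul1r : right_id dlim_one dlim_mul.
Proof.
move=> x; have [k [a [b [c [-> _ _]]]]] := dlim_in_surj3 x x x.
by rewrite -(dlim_in1 k) -dlim_in_mul mulr1.
Qed.

Lemma dlim_mulDl : left_distributive dlim_mul dlim_add.
Proof.
move=> x y z; have [k [a [b [c [-> -> ->]]]]] := dlim_in_surj3 x y z.
by rewrite -dlim_in_add -!dlim_in_mul -dlim_in_add mulrDl.
Qed.

Lemma dlim_mulDr : right_distributive dlim_mul dlim_add.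
Proof.
move=> x y z; have [k [a [b [c [-> -> ->]]]]] := dlim_in_surj3 x y z.
by rewrite -dlim_in_add -!dlim_in_mul -dlim_in_add mulrDr.
Qed.

HB.instance Definition _ := GRing.isPzRing.Build dlim
  dlim_addA dlim_addC dlim_add0 dlim_addN
  dlim_mulA dlim_mul1l dlim_mul1r dlim_mulDl dlim_mulDr.

Lemma dlim_in_is_zmod_morphism (k : nat) : zmod_morphism (@dlim_in k).
Proof. by move=> x y; rewrite dlim_in_add dlim_in_opp. Qed.

Lemma dlim_in_is_monoid_morphism (k : nat) : monoid_morphism (@dlim_in k).
Proof. by split=> [|x y]; [exact: dlim_in1 | exact: dlim_in_mul]. Qed.

HB.instance Definition _ (k : nat) := GRing.isZmodMorphism.Build
  (R_ k) dlim (@dlim_in k) (@dlim_in_is_zmod_morphism k).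
HB.instance Definition _ (k : nat) := GRing.isMonoidMorphism.Build
  (R_ k) dlim (@dlim_in k) (@dlim_in_is_monoid_morphism k).

Lemma dlim_in_compat (k : nat) (x : R_ k) : dlim_in (f k x) = dlim_in x.
Proof.
rewrite -[RHS](@dlim_in_stage k.+1) ?leqnSn // stageS //.
by rewrite stage_tag.
Qed.

Lemma dlim_in_surj (x : dlim) : exists k (a : R_ k), x = dlim_in a.
Proof. by have [k [a [_ [_ [-> _ _]]]]] := dlim_in_surj3 x x x; exists k, a. Qed.

Lemma dlim_in_inj (k : nat) :
  (forall j, injective (f j)) -> injective (@dlim_in k).
Proof.
move=> finj x y /dlim_piP[m e].
have {e}: stage (maxn k m) (Tagged R_ x) = stage (maxn k m) (Tagged R_ y).
  by apply: e; rewrite leq_maxr.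
move: (maxn k m) (leq_maxl k m) => p; elim: p => [|p IHp] kp.
  by move: kp; rewrite leqn0 => /eqP kp; subst k; rewrite !stage_tag.
move: kp; rewrite leq_eqVlt ltnS => /orP[/eqP kp|kp].
  by subst k; rewrite !stage_tag.
by rewrite !stageS // => /finj/(IHp kp).
Qed.

End DirectLimit.

Lemma sum_expnS (n k : nat) : (\sum_(i < n) n ^ k)%N = (n ^ k.+1)%N.
Proof. by rewrite sum_nat_const card_ord expnS. Qed.

(* A |-> diag(A, ..., A), with n blocks. *)
Definition block_diag (R : pzRingType) (n k : nat) (A : 'M[R]_(n ^ k)) :
    'M[R]_(n ^ k.+1) :=
  castmx (sum_expnS n k, sum_expnS n k) (\mxdiag_(i < n) A).

Section BlockDiag.
Variables (R : pzRingType) (n k : nat).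
Local Notation bd := (@block_diag R n k).

Lemma block_diag_is_zmod_morphism : zmod_morphism bd.
Proof.
by move=> A B; rewrite /block_diag mxdiagB; case: _ / (sum_expnS n k).
Qed.

Lemma block_diag_is_monoid_morphism : monoid_morphism bd.
Proof.
split=> [|A B]; rewrite /block_diag.
  by rewrite mxdiagZ; case: _ / (sum_expnS n k).
suff -> : \mxdiag_(i < n) (A * B) = \mxdiag_(i < n) A *m \mxdiag_(i < n) B.
  by case: _ / (sum_expnS n k).
rewrite {2 3}/mxdiag mul_mxblock_mxdiag; apply: eq_mxblock => i j.
by case: eqP => _; rewrite ?conform_mx_id ?mul0mx.
Qed.

HB.instance Definition _ := GRing.isZmodMorphism.Build
  'M[R]_(n ^ k) 'M[R]_(n ^ k.+1) bd block_diag_is_zmod_morphism.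
HB.instance Definition _ := GRing.isMonoidMorphism.Build
  'M[R]_(n ^ k) 'M[R]_(n ^ k.+1) bd block_diag_is_monoid_morphism.

Lemma block_diag_inj : (0 < n)%N -> injective bd.
Proof.
by move=> n0 A B /(can_inj (castmxK _ _)) /eq_mxdiagP /(_ (Ordinal n0)).
Qed.

End BlockDiag.

(* [MC n R] is the n-matricial closure of R; its first stage is the ring
   ['M[R]_(n ^ 0)] of 1 x 1 matrices over R.  For n = 1 all the transition maps
   are identities, so that [MC 1 R] is just R. *)
Definition MC (n : nat) (R : pzRingType) : pzRingType :=
  dlim (fun k => @block_diag R n k : {rmorphism 'M[R]_(n ^ k) -> 'M[R]_(n ^ k.+1)}).

(* Main.v *)
(* The columns indexed by nat form a left MC n K-module E, a matrix of size n ^ k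
   acting on each block of n ^ k consecutive entries; the finitely supported
   columns form a simple submodule S.  Were S injective, there would be a
   retraction h : E -> S.  Let v be the indicator of {1, n, n ^ 2, ...} and let
   A_j be the matrix unit of size n ^ j.+1 at (0, n ^ j).  No other power of n is
   congruent to n ^ j modulo n ^ j.+1, so A_j v is the basis column at 0, hence
   lies in S and is fixed by h.  Thus A_j (h v) = h (A_j v) = A_j v, i.e. the
   entry of h v at n ^ j is 1 for all j, contradicting finite support. *)
Require Import Defs.
From HB Require Import structures.
From mathcomp Require Import all_boot all_order all_algebra.
From mathcomp Require Import generic_quotient boolp functions.

Set Implicit Arguments.
Unset Strict Implicit.
Unset Printing Implicit Defensive.

Import GRing.Theory.
Local Open Scope quotient_scope.
Local Open Scope ring_scope.

(* The parameter [m] is a phantom: it selects the module structure over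
   [MC m.+1 K]. *)
Definition omega_col (m : nat) (K : fieldType) : Type := nat -> K.

HB.instance Definition _ (m : nat) (K : fieldType) :=
  GRing.Zmodule.copy (omega_col m K) (nat -> K).

Section OmegaColumns.
Variables (m : nat) (K : fieldType).
Local Notation n := m.+1.
Local Notation E := (omega_col m K).
Implicit Types (k q i : nat) (v : E).

(** * Blockwise action of matrices of size [n ^ k] on columns *)

Lemma block_size_gt0 k : (0 < n ^ k)%N. Proof. by rewrite expn_gt0. Qed.

Definition block k v q : 'cV[K]_(n ^ k) := \col_j v (q * n ^ k + j)%N.

Definition block_act k (A : 'M[K]_(n ^ k)) v : E := fun i =>
  (A *m block k v (i %/ n ^ k)) (Ordinal (ltn_pmod i (block_size_gt0 k))) 0.

Lemma block_block_act k (A : 'M[K]_(n ^ k)) v q :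
  block k (block_act A v) q = A *m block k v q.
Proof.
apply/matrixP => j c; rewrite mxE /block_act (ord1 c).
rewrite divnMDl ?block_size_gt0 // (divn_small (ltn_ord j)) addn0.
by congr (_ _ _); apply: val_inj; rewrite /= modnMDl modn_small.
Qed.

Lemma block_inj k v w : block k v =1 block k w -> v = w.
Proof.
move=> vw; apply/funext => i.
have /matrixP/(_ (Ordinal (ltn_pmod i (block_size_gt0 k))) 0) := vw (i %/ n ^ k)%N.
by rewrite !mxE /= -divn_eq.
Qed.

Lemma blockD k v w q : block k (v + w) q = block k v q + block k w q.
Proof. by apply/matrixP => i j; rewrite !mxE. Qed.

Lemma blockS k v q : block k.+1 v q =
  castmx (sum_expnS n k, erefl) (\mxcol_(b < n) block k v (q * n + b)).
Proof.
apply/matrixP => i c; rewrite castmxE !mxE /=; congr v.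
(* An index in the stacked column is the total size of the preceding blocks, all equal to [n ^ k],
   plus an index within its own block. *)
rewrite [X in (_ + X)%N](tagnat.rect (cast_ord (esym (sum_expnS n k)) i)).
rewrite (big_ord_narrow (ltnW (ltn_ord _))) sum_nat_const card_ord addnA.
by rewrite mulnDl -mulnA -expnS.
Qed.

(** This compatibility with the transition maps is what lets the action pass to the direct limit. *)
Lemma block_act_block_diag k (A : 'M[K]_(n ^ k)) v :
  block_act (block_diag A) v = block_act A v.
Proof.
apply: (@block_inj k.+1) => q; rewrite block_block_act !blockS /block_diag.
under [X in _ = castmx _ X]eq_mxcol do rewrite block_block_act.
rewrite -mul_mxdiag_mxcol.
by case: _ / (sum_expnS n k).
Qed.

Lemma block_actM k (A B : 'M[K]_(n ^ k)) v :
  block_act (A *m B) v = block_act A (block_act B v).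
Proof. by apply: (@block_inj k) => q; rewrite !block_block_act mulmxA. Qed.

Lemma block_act1 k v : block_act (1%:M : 'M[K]_(n ^ k)) v = v.
Proof. by apply: (@block_inj k) => q; rewrite block_block_act mul1mx. Qed.

Lemma block_actDl k (A B : 'M[K]_(n ^ k)) v :
  block_act (A + B) v = block_act A v + block_act B v.
Proof.
by apply: (@block_inj k) => q; rewrite blockD !block_block_act mulmxDl.
Qed.

Lemma block_actDr k (A : 'M[K]_(n ^ k)) v w :
  block_act A (v + w) = block_act A v + block_act A w.
Proof.
by apply: (@block_inj k) => q; rewrite !(blockD, block_block_act) mulmxDr.
Qed.

Lemma block_act_delta k (a b : 'I_(n ^ k)) v i :
  block_act (delta_mx a b) v i =
  v (i %/ n ^ k * n ^ k + b)%N *+ (i %% n ^ k == a)%N.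
Proof.
rewrite /block_act mxE (bigD1 b) //= big1 => [|j jb]; last first.
  by rewrite !mxE (negPf jb) andbF mul0r.
by rewrite !mxE eqxx andbT addr0 mulr_natl.
Qed.

(** * The left [MC n K]-module structure on columns *)

Local Notation bd := (fun k => @block_diag K n k :
  {rmorphism 'M[K]_(n ^ k) -> 'M[K]_(n ^ k.+1)}).

Definition MC_in k (A : 'M[K]_(n ^ k)) : MC n K := dlim_in bd A.

HB.instance Definition _ k := GRing.isZmodMorphism.Build
  'M[K]_(n ^ k) (MC n K) (@MC_in k) (@dlim_in_is_zmod_morphism _ bd k).
HB.instance Definition _ k := GRing.isMonoidMorphism.Build
  'M[K]_(n ^ k) (MC n K) (@MC_in k) (@dlim_in_is_monoid_morphism _ bd k).

(** Uses a chosen representative; [MC_act_in] shows that the choice is immaterial. *)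
Definition MC_act (x : MC n K) v : E := block_act (tagged (repr (x : dlim bd))) v.

Lemma block_act_stage p (u : {k & 'M[K]_(n ^ k)}) v : (tag u <= p)%N ->
  block_act (stage bd p u) v = block_act (tagged u) v.
Proof.
elim: p => [|p IHp] up.
  case: u up => j B /=; rewrite leqn0 => /eqP j0; subst j.
  by congr block_act; exact: (stage_tag bd).
move: up; rewrite leq_eqVlt ltnS => /orP[/eqP up|up].
  case: u up {IHp} => j B /= jp; subst j.
  by congr block_act; exact: (stage_tag bd).
by rewrite stageS // block_act_block_diag IHp.
Qed.

Lemma MC_act_in k (A : 'M[K]_(n ^ k)) v : MC_act (MC_in A) v = block_act A v.
Proof.
rewrite /MC_act; set u := repr _.
have /dlim_piP[p e] : \pi_(dlim bd) u = dlim_in bd A by rewrite reprK.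
have := e _ (leq_maxl p (maxn (tag u) k)).
move=> /(congr1 (fun B => block_act B v)).
by rewrite !block_act_stage //= !leq_max leqnn !orbT.
Qed.

Lemma MC_in_surj3 (x y z : MC n K) : exists k (A B C : 'M[K]_(n ^ k)),
  [/\ x = MC_in A, y = MC_in B & z = MC_in C].
Proof. exact: dlim_in_surj3. Qed.

Lemma MC_actA x y v : MC_act x (MC_act y v) = MC_act (x * y) v.
Proof.
have [k [A [B [_ [-> -> _]]]]] := MC_in_surj3 x y y.
by rewrite -rmorphM !MC_act_in block_actM.
Qed.

Lemma MC_act1 : left_id 1 MC_act.
Proof. by move=> v; rewrite -(rmorph1 (@MC_in 0)) MC_act_in block_act1. Qed.

Lemma MC_actDr : right_distributive MC_act +%R.
Proof.
move=> x v w; have [k [A [_ [_ [-> _ _]]]]] := MC_in_surj3 x x x.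
by rewrite !MC_act_in block_actDr.
Qed.

Lemma MC_actDl v : {morph MC_act^~ v : x y / x + y}.
Proof.
move=> x y; have [k [A [B [_ [-> -> _]]]]] := MC_in_surj3 x y y.
by rewrite -rmorphD !MC_act_in block_actDl.
Qed.

HB.instance Definition _ := GRing.Zmodule_isLmodule.Build (MC n K) E
  MC_actA MC_act1 MC_actDr MC_actDl.

Lemma scale_MC_in k (A : 'M[K]_(n ^ k)) v : MC_in A *: v = block_act A v.
Proof. exact: MC_act_in. Qed.

(** * The submodule of finitely supported columns *)

Definition finsupp : {pred E} :=
  fun v => `[< exists N, forall i, (N <= i)%N -> v i = 0 >].

Lemma finsuppP v :
  reflect (exists N, forall i, (N <= i)%N -> v i = 0) (v \in finsupp).
Proof. exact: asboolP. Qed.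

Lemma finsupp_submod_closed : GRing.submod_closed finsupp.
Proof.
split=> [|x v w /finsuppP[M vM] /finsuppP[N wN]].
  by apply/finsuppP; exists 0%N.
have [k [A [_ [_ [-> _ _]]]]] := MC_in_surj3 x x x; rewrite scale_MC_in.
(* Beyond this bound the block of [i] has index at least [M], so all its positions are at least [M],
   where [v] vanishes. *)
apply/finsuppP; exists (maxn (M.+1 * n ^ k)%N N) => i.
rewrite geq_max => /andP[Mi /wN].
rewrite -[(_ + w) i]/(_ i + w i) => ->; rewrite addr0 /block_act.
suff -> : block k v (i %/ n ^ k) = 0 by rewrite mulmx0 mxE.
apply/matrixP => j c; rewrite !mxE vM // (leq_trans _ (leq_addr _ _)) //.
rewrite (leq_trans _ (leq_pmulr _ (block_size_gt0 k))) //.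
by rewrite leq_divRL ?block_size_gt0 // (leq_trans _ Mi) // leq_mul2r leqnSn orbT.
Qed.

HB.instance Definition _ :=
  GRing.isSubmodClosed.Build (MC n K) E finsupp finsupp_submod_closed.

Record fin_omega_col : Type :=
  FinOmegaCol { fin_col :> E; _ : fin_col \in finsupp }.

HB.instance Definition _ := [isSub for fin_col].
HB.instance Definition _ := [Choice of fin_omega_col by <:].
HB.instance Definition _ := [SubChoice_isSubLmodule of fin_omega_col by <:].

Lemma val_scale_MC_in k (A : 'M[K]_(n ^ k)) (s : fin_omega_col) :
  val (MC_in A *: s) = block_act A (val s).
Proof. by rewrite linearZ; exact: scale_MC_in. Qed.

Definition unit_col : E := fun i => (i == 0)%N%:R.

Lemma unit_col_finsupp : unit_col \in finsupp.
Proof. by apply/finsuppP; exists 1%N => -[]. Qed.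

Definition powers_indicator : E := fun i => `[< exists j, i = (n ^ j)%N >]%:R.

(** * Simplicity and failure of injectivity *)

Hypothesis n_gt1 : (1 < n)%N.

(* If [s i0 != 0], then the matrix whose only nonzero column is t / s i0, at
   position i0, maps s to t. *)
Lemma fin_omega_col_simple : simple_module fin_omega_col.
Proof.
split=> [|U [U0 Ulin]].
  exists (FinOmegaCol unit_col_finsupp).
  move=> /(congr1 val)/(congr1 (fun v : E => v 0%N)).
  by rewrite linear0 => /eqP; rewrite oner_eq0.
have [[s [sU s0]]|noU] := pselect (exists s, s \in U /\ s <> 0);
  [right|left]; last first.
  by move=> s sU; apply: contrapT => s0; apply: noU; exists s.
move=> t.
have [i0 si0] : exists i, val s i != 0.
  apply: contrapT => si; apply: s0; apply/val_inj/funext => i.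
  by rewrite linear0; apply: contrapT => /eqP si0; apply: si; exists i.
have /finsuppP[N tN] := valP t; have /finsuppP[M sM] := valP s.
(* At stage [l] the block at 0 contains [i0] and the supports of [s] and [t]. *)
have [l [Nl Ml il]] : exists l, [/\ N < n ^ l, M < n ^ l & i0 < n ^ l]%N.
  have lt_exp := ltn_expl (N + M + i0) n_gt1; exists (N + M + i0)%N.
  split; apply: leq_ltn_trans lt_exp; last exact: leq_addl.
    by rewrite -addnA leq_addr.
  by rewrite -addnA addnCA leq_addr.
suff -> : t = MC_in (\matrix_(i, j < n ^ l)
    ((j == i0 :> nat)%:R * (val t i / val s i0))) *: s + 0.
  exact: Ulin.
rewrite addr0; apply/val_inj/funext => i; rewrite val_scale_MC_in /block_act.
rewrite mxE (bigD1 (Ordinal il)) //= big1 => [|j]; last first.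
  by rewrite -val_eqE /= !mxE => /negPf ->; rewrite !mul0r.
rewrite !mxE /= eqxx mul1r addr0.
have [il'|li] := ltnP i (n ^ l).
  by rewrite modn_small // divn_small // mul0n add0n divfK.
(* Outside the block at 0 both sides vanish: the entry of [s] that is read lies at a position at
   least [n ^ l]. *)
rewrite (tN i (leq_trans (ltnW Nl) li)) [X in _ * X]sM ?mulr0 //.
apply: leq_trans (leq_addr _ _); apply: leq_trans (ltnW Ml) _.
by rewrite leq_pmull // divn_gt0 ?block_size_gt0.
Qed.

Lemma powers_indicator_delta j (a b : 'I_(n ^ j.+1)) :
    a = 0%N :> nat -> b = (n ^ j)%N :> nat ->
  block_act (delta_mx a b) powers_indicator = unit_col.
Proof.
move=> a0 bj; apply/funext => i.
rewrite block_act_delta a0 bj /powers_indicator /unit_col.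
have [q0|qN0] := posnP (i %/ n ^ j.+1).
  rewrite q0 mul0n add0n; have /asboolT -> : exists l, (n ^ j = n ^ l)%N by exists j.
  by rewrite [in RHS](divn_eq i (n ^ j.+1)) q0.
have iN0 : (i == 0)%N = false.
  by apply/negbTE; apply: contraTneq qN0 => ->; rewrite div0n.
rewrite iN0; case: asboolP => [[l e]|_]; last by rewrite mul0rn.
(* A power [n ^ l] in a later block exceeds [n ^ j], so [n ^ j.+1] divides it and hence also
   [n ^ j], which is absurd. *)
have jl : (j < l)%N.
  rewrite -(ltn_exp2l _ _ n_gt1) -e -[ltnLHS]add0n ltn_add2r.
  by rewrite muln_gt0 qN0 block_size_gt0.
have : (n ^ j.+1 %| n ^ j)%N.
  by rewrite -(dvdn_addr _ (dvdn_mull (i %/ n ^ j.+1) (dvdnn _))) e dvdn_exp2l.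
by move=> /(dvdn_leq (block_size_gt0 j)); rewrite leq_exp2l // ltnn.
Qed.

Lemma fin_omega_col_not_injective : ~ injective_module fin_omega_col.
Proof.
move=> inj.
have [h hK] := inj fin_omega_col E val idfun val_inj.
(* The support bound [j] doubles as the exponent: since [j < n ^ j], the entry of
   [h powers_indicator] at [n ^ j] is 0. *)
have /finsuppP[j hj] := valP (h powers_indicator).
have jj : (n ^ j < n ^ j.+1)%N by rewrite ltn_exp2l.
pose A : 'M[K]_(n ^ j.+1) := delta_mx (Ordinal (block_size_gt0 _)) (Ordinal jj).
have Av : MC_in A *: powers_indicator = unit_col.
  by rewrite scale_MC_in powers_indicator_delta.
have Av_fs : MC_in A *: powers_indicator \in finsupp.
  by rewrite Av unit_col_finsupp.
(* At position 0, linearity of [h] turns the left side into that zero entry, while the right side is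
   1. *)
have /(congr1 val)/(congr1 (fun v : E => v 0%N)) := hK (FinOmegaCol Av_fs).
rewrite /= linearZ val_scale_MC_in block_act_delta Av mod0n div0n mul0n add0n /=.
rewrite (hj _ (ltnW (ltn_expl j n_gt1))) => /esym/eqP.
by rewrite mul0rn oner_eq0.
Qed.

End OmegaColumns.

(** The case [n = 1] is a genuine exception: [MC 1 K] is the field [K], over which every module is
    injective. *)
Theorem proposition28 (n : nat) (n_gt1 : (1 < n)%N) (K : fieldType) :
  ~ left_V_ring (MC n K).
Proof.
case: n n_gt1 => // m n_gt1 V.
exact: (fin_omega_col_not_injective n_gt1 (V _ (fin_omega_col_simple K n_gt1))).
Qed.
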